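(* Let $a,k,r$ be non-negative integers with $a<k<r$. Then for every integer $n\ge r$, \[ g^{(k)}_{\{0,1,\dots,a\}}(n)\ \ge\ g^{(r)}_{\{0,1,\dots,a\}}(n)\ \ge\ g^{(k)}_{\{0,1,\dots,a\}}(n-r+k), \] and for every integer $n\ge r-k$, \[ h^{(k)}_{\{0,1,\dots,a\}}(n)\ \ge\ h^{(r)}_{\{0,1,\dots,a\}}(n)\ \ge\ h^{(k)}_{\{0,1,\dots,a\}}(n-r+k). \]
   Context: An $r$-uniform hypergraph is a finite vertex set with a family of $r$-element subsets (hyperedges). A vertex is isolated if it lies in no hyperedge. Given a non-empty set $A$ of non-negative integers, a set $S$ of vertices is an $A$-transversal of an $r$-uniform hypergraph $\mathcal{H}$ if $|H\cap S|\in A$ for every hyperedge $H$; it is maximal if it is not a proper subset of another $A$-transversal. For $n\ge r$, $g^{(r)}_A(n)$ denotes the maximum number of $A$-transversals in an $r$-uniform hypergraph on $n$ vertices with no isolated vertices, and $h^{(r)}_A(n)$ denotes the maximum number of maximal $A$-transversals in an $r$-uniform hypergraph on $n$ vertices (isolated vertices allowed). *)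

(* Defs.v *)
From mathcomp Require Import all_boot.

Set Implicit Arguments.
Unset Strict Implicit.
Unset Printing Implicit Defensive.

(* A hypergraph on the vertex set T is given by its set E of hyperedges. *)

Definition uniform (T : finType) (r : nat) (E : {set {set T}}) : bool :=
  [forall H in E, #|H| == r].

Definition isolated (T : finType) (E : {set {set T}}) (v : T) : bool :=
  [forall H in E, v \notin H].

Definition Atransversal (T : finType) (A : pred nat) (E : {set {set T}})
    (S : {set T}) : bool :=
  [forall H in E, A #|H :&: S|].

Definition maximal_Atransversal (T : finType) (A : pred nat) (E : {set {set T}})
    (S : {set T}) : bool :=
  maxset (Atransversal A E) S.

(* For 0 < r <= n the complete r-uniform hypergraph has no isolated vertices,
   so the range of this maximum is nonempty and the default value 0 of \max
   plays no role. *)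
Definition g (r : nat) (A : pred nat) (n : nat) : nat :=
  \max_(E : {set {set 'I_n}} | uniform r E && [forall v, ~~ isolated E v])
     #|[set S | Atransversal A E S]|.

(* The range contains the edgeless hypergraph for all r and n. *)
Definition h (r : nat) (A : pred nat) (n : nat) : nat :=
  \max_(E : {set {set 'I_n}} | uniform r E)
     #|[set S | maximal_Atransversal A E S]|.

Definition upto (a : nat) : pred nat := [pred i | i <= a].

(* Main.v *)
Require Import Defs.
From mathcomp Require Import all_boot.

Set Implicit Arguments.
Unset Strict Implicit.
Unset Printing Implicit Defensive.

(** A set is a [{0, ..., a}]-transversal exactly when it contains no
    [(a + 1)]-subset of a hyperedge.  For [a < k <= r], an [r]-uniform
    hypergraph and its [k]-shadow (the [k]-subsets of its hyperedges) have the
    same [(a + 1)]-subsets of hyperedges, hence the same transversals: this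
    gives the upper bounds.  For the lower bounds, add the same [r - k] new
    vertices to every hyperedge of a [k]-uniform hypergraph: each old
    transversal is still a transversal, and a maximal one extends to a maximal
    one whose trace on the old vertices is unchanged. *)

Lemma exists_card_between (T : finType) (A B : {set T}) (k : nat) :
  A \subset B -> #|A| <= k <= #|B| ->
  exists C : {set T}, [/\ A \subset C, C \subset B & #|C| = k].
Proof.
move=> sAB /andP[]; elim: k => [|k IHk].
  by rewrite leqn0 => /eqP A0 _; exists A; split.
rewrite leq_eqVlt => /orP[/eqP <- _|leAk ltkB]; first by exists A; split.
have [C [sAC sCB cardC]] := IHk leAk (ltnW ltkB).
have /properP[_ [x xB xNC]] : C \proper B by rewrite properEcard sCB cardC.
exists (x |: C); split.
- exact: subset_trans sAC (subsetUr _ _).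
- by rewrite subUset sub1set xB.
- by rewrite cardsU1 xNC cardC.
Qed.

Definition downward_closed (A : pred nat) : Prop :=
  forall i j, i <= j -> A j -> A i.

Lemma downward_closed_upto a : downward_closed (upto a).
Proof. by move=> i j; apply: leq_trans. Qed.

Section Hypergraph.

Context {T : finType}.
Implicit Types (A : pred nat) (E : {set {set T}}).

Definition no_isolated E : bool := [forall v, ~~ isolated E v].

Definition Atransversals A E : {set {set T}} :=
  [set S | Atransversal A E S].

Definition maximal_Atransversals A E : {set {set T}} :=
  [set S | maximal_Atransversal A E S].

Lemma uniformP r E : reflect {in E, forall H : {set T}, #|H| = r} (uniform r E).
Proof.
by apply: (iffP forall_inP) => unifE H HE; apply/eqP; rewrite ?unifE.
Qed.

Lemma leq_card_uniform k r E : k <= r -> uniform r E ->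
  {in E, forall H : {set T}, k <= #|H|}.
Proof. by move=> le_kr /uniformP unifE H /unifE->. Qed.

Lemma no_isolated_neq0 E : 0 < #|T| -> no_isolated E -> E != set0.
Proof.
move=> /card_gt0P[v _] /forallP/(_ v)/forall_inPn[H HE _].
by apply/set0Pn; exists H.
Qed.

Lemma Atransversal_subset A E (S1 S2 : {set T}) :
  downward_closed A -> S1 \subset S2 ->
  Atransversal A E S2 -> Atransversal A E S1.
Proof.
move=> closedA sS12 /forall_inP trS2; apply/forall_inP => H HE.
exact: closedA (subset_leq_card (setIS H sS12)) (trS2 H HE).
Qed.

End Hypergraph.

Section Shadow.

Context {T : finType}.
Implicit Types (E : {set {set T}}) (K S : {set T}) (v : T).

Definition shadow (k : nat) E : {set {set T}} :=
  [set K : {set T} | (#|K| == k) && [exists H in E, K \subset H]].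

Lemma shadowP k E K :
  reflect (#|K| = k /\ exists2 H, H \in E & K \subset H) (K \in shadow k E).
Proof.
by rewrite inE; apply: (iffP andP) => -[/eqP cardK /exists_inP sKE].
Qed.

Lemma uniform_shadow k E : uniform k (shadow k E).
Proof. by apply/uniformP => K /shadowP[]. Qed.

Lemma isolated_shadow1 E v : isolated E v = ([set v] \notin shadow 1 E).
Proof.
rewrite inE cards1 /= negb_exists_in.
by apply: eq_forallb => H; rewrite sub1set.
Qed.

Lemma Atransversal_upto_shadow a E S :
  Atransversal (upto a) E S = [forall K in shadow a.+1 E, ~~ (K \subset S)].
Proof.
apply/forall_inP/forall_inP => [trS K /shadowP[cardK [H HE sKH]]|noK H HE].
  apply/negP => sKS; have : #|H :&: S| <= a := trS H HE.
  by apply/negP; rewrite -ltnNge -cardK subset_leq_card // subsetI sKH.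
have [//|lt_a_HS] := leqP #|H :&: S| a.
have [|K [_ + cardK]] := @exists_card_between _ _ _ a.+1 (sub0set (H :&: S)).
  by rewrite cards0.
rewrite subsetI => /andP[sKH sKS].
have K_shadow : K \in shadow a.+1 E by apply/shadowP; split=> //; exists H.
by have := noK K K_shadow; rewrite sKS.
Qed.

Section LargeEdges.

Variables (k : nat) (E : {set {set T}}).
Hypothesis leq_card_edge : {in E, forall H : {set T}, k <= #|H|}.

Lemma shadow_shadow j : j <= k -> shadow j (shadow k E) = shadow j E.
Proof.
move=> le_jk; apply/setP => K; apply/shadowP/shadowP => -[cardK [H HE sKH]].
  have [_ [H' H'E sHH']] := shadowP _ _ _ HE.
  by split=> //; exists H' => //; apply: subset_trans sHH'.
have [|L [sKL sLH cardL]] := @exists_card_between _ _ _ k sKH.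
  by rewrite cardK le_jk leq_card_edge.
by split=> //; exists L => //; apply/shadowP; split=> //; exists H.
Qed.

Lemma isolated_shadow v : 0 < k -> isolated (shadow k E) v = isolated E v.
Proof. by move=> k_gt0; rewrite !isolated_shadow1 shadow_shadow. Qed.

Lemma Atransversal_shadow a S : a < k ->
  Atransversal (upto a) (shadow k E) S = Atransversal (upto a) E S.
Proof. by move=> lt_ak; rewrite !Atransversal_upto_shadow shadow_shadow. Qed.

Lemma Atransversals_shadow a : a < k ->
  Atransversals (upto a) (shadow k E) = Atransversals (upto a) E.
Proof.
by move=> lt_ak; apply/setP => S; rewrite !inE Atransversal_shadow.
Qed.

Lemma maximal_Atransversals_shadow a : a < k ->
  maximal_Atransversals (upto a) (shadow k E) =
  maximal_Atransversals (upto a) E.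
Proof.
move=> lt_ak; apply/setP => S; rewrite !inE; apply: maxset_eq => S'.
exact: Atransversal_shadow.
Qed.

End LargeEdges.

End Shadow.

Section Extension.

Context {T U : finType}.
Variable f : T -> U.
Hypothesis f_inj : injective f.
Implicit Types (A : pred nat) (E : {set {set T}}) (H S : {set T}).

(* [f @: H] together with all the vertices outside the image of [f] *)
Definition extend_edge H : {set U} := ~: (f @: ~: H).

Definition extend E : {set {set U}} := extend_edge @: E.

Lemma mem_extend_edge H x : (f x \in extend_edge H) = (x \in H).
Proof. by rewrite inE mem_imset // inE negbK. Qed.

Lemma mem_extend_edge_out H y : y \notin codom f -> y \in extend_edge H.
Proof. by rewrite inE; apply/contraNN => /imsetP[x _ ->]; apply: codom_f. Qed.

Lemma card_extend_edge H : #|extend_edge H| = #|H| + (#|U| - #|T|).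
Proof.
rewrite cardsCs setCK card_imset // [#|~: H|]cardsCs setCK.
by rewrite subnBA ?max_card // addnC addnBA // (leq_card f).
Qed.

Lemma extend_edgeI H S : extend_edge H :&: f @: S = f @: (H :&: S).
Proof.
apply/setP => y; apply/setIP/imsetP => [[fH /imsetP[x xS def_y]]|[x]].
  by exists x => //; rewrite inE xS andbT -mem_extend_edge -def_y.
by move=> /setIP[xH xS] ->; rewrite mem_extend_edge mem_imset.
Qed.

Lemma uniform_extend k E :
  uniform k E -> uniform (k + (#|U| - #|T|)) (extend E).
Proof.
move=> /uniformP unifE; apply/uniformP => _ /imsetP[H HE ->].
by rewrite card_extend_edge unifE.
Qed.

Lemma no_isolated_extend E :
  E != set0 -> no_isolated E -> no_isolated (extend E).
Proof.
move=> /set0Pn[H0 H0E] /forallP covE; apply/forallP => y; apply/forall_inPn.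
have [/codomP[x ->]|y_out] := boolP (y \in codom f).
  have /forall_inPn[H HE] := covE x; rewrite negbK => xH.
  by exists (extend_edge H); rewrite ?imset_f ?negbK ?mem_extend_edge.
by exists (extend_edge H0); rewrite ?imset_f ?negbK ?mem_extend_edge_out.
Qed.

Lemma Atransversal_extend_imset A E S :
  Atransversal A (extend E) (f @: S) = Atransversal A E S.
Proof.
apply/forall_inP/forall_inP => [trS H HE|trS _ /imsetP[H HE ->]].
  by rewrite -(card_imset _ f_inj) -extend_edgeI trS ?imset_f.
by rewrite extend_edgeI card_imset // trS.
Qed.

Lemma leq_card_Atransversals_extend A E :
  #|Atransversals A E| <= #|Atransversals A (extend E)|.
Proof.
rewrite -(card_imset _ (imset_inj f_inj)).
apply/subset_leq_card/subsetP => _ /imsetP[S trS ->].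
by rewrite !inE Atransversal_extend_imset in trS *.
Qed.

Section DownwardClosed.

Variable A : pred nat.
Hypothesis closedA : downward_closed A.

Lemma Atransversal_extend_preimset E (V : {set U}) :
  Atransversal A (extend E) V -> Atransversal A E (f @^-1: V).
Proof.
move=> trV; rewrite -Atransversal_extend_imset.
by apply: Atransversal_subset trV; rewrite ?sub_imset_pre.
Qed.

Lemma maximal_Atransversal_extend E S : maximal_Atransversal A E S ->
  exists2 V, maximal_Atransversal A (extend E) V & S = f @^-1: V.
Proof.
move=> /maxsetP[trS maxS].
have [|V maxV sfSV] := @maxset_exists _ (Atransversal A (extend E)) (f @: S).
  by rewrite Atransversal_extend_imset.
exists V => //; apply/esym/maxS; last by rewrite -sub_imset_pre.
exact/Atransversal_extend_preimset/(maxsetp maxV).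
Qed.

Lemma leq_card_maximal_Atransversals_extend E :
  #|maximal_Atransversals A E| <= #|maximal_Atransversals A (extend E)|.
Proof.
apply: leq_trans (leq_imset_card (fun V : {set U} => f @^-1: V) _).
apply/subset_leq_card/subsetP => S; rewrite inE.
move=> /maximal_Atransversal_extend[V maxV ->].
by apply/imsetP; exists V; rewrite ?inE.
Qed.

End DownwardClosed.

End Extension.

Section ExtremalNumbers.

Implicit Types (A : pred nat) (a k r m n : nat).

Lemma leq_card_Atransversals_g r A n (E : {set {set 'I_n}}) :
  uniform r E -> no_isolated E -> #|Atransversals A E| <= g r A n.
Proof.
move=> unifE covE.
by apply: (leq_bigmax_cond (F := fun E => #|Atransversals A E|)); apply/andP.
Qed.

Lemma leq_card_maximal_Atransversals_h r A n (E : {set {set 'I_n}}) :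
  uniform r E -> #|maximal_Atransversals A E| <= h r A n.
Proof.
exact: (leq_bigmax_cond (F := fun E => #|maximal_Atransversals A E|)).
Qed.

Lemma leq_g_shadow a k r n : a < k <= r -> g r (upto a) n <= g k (upto a) n.
Proof.
move=> /andP[lt_ak le_kr]; apply/bigmax_leqP => E /andP[unifE covE].
have geE := leq_card_uniform le_kr unifE.
rewrite -/(Atransversals _ _) -(Atransversals_shadow geE) //.
apply: leq_card_Atransversals_g; first exact: uniform_shadow.
apply/forallP => v; rewrite isolated_shadow ?(forallP covE) //.
exact: leq_ltn_trans lt_ak.
Qed.

Lemma leq_h_shadow a k r n : a < k <= r -> h r (upto a) n <= h k (upto a) n.
Proof.
move=> /andP[lt_ak le_kr]; apply/bigmax_leqP => E unifE.
have geE := leq_card_uniform le_kr unifE.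
rewrite -/(maximal_Atransversals _ _) -(maximal_Atransversals_shadow geE) //.
exact/leq_card_maximal_Atransversals_h/uniform_shadow.
Qed.

Lemma widen_ord_inj m n (le_mn : m <= n) : injective (widen_ord le_mn).
Proof. by move=> i j /(congr1 val) /= /val_inj. Qed.

Lemma uniform_extend_widen k m n (le_mn : m <= n) (E : {set {set 'I_m}}) :
  uniform k E -> uniform (k + (n - m)) (extend (widen_ord le_mn) E).
Proof.
by move=> /(uniform_extend (@widen_ord_inj _ _ le_mn)); rewrite !card_ord.
Qed.

Lemma leq_g_extend k A m n : 0 < m <= n -> g k A m <= g (k + (n - m)) A n.
Proof.
move=> /andP[m_gt0 le_mn]; have widen_inj := @widen_ord_inj _ _ le_mn.
apply/bigmax_leqP => E /andP[unifE covE].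
apply: leq_trans (leq_card_Atransversals_extend widen_inj A E) _.
apply: leq_card_Atransversals_g; first exact: uniform_extend_widen.
by apply: no_isolated_extend; rewrite ?no_isolated_neq0 ?card_ord.
Qed.

Lemma leq_h_extend k A m n :
  downward_closed A -> m <= n -> h k A m <= h (k + (n - m)) A n.
Proof.
move=> closedA le_mn; have widen_inj := @widen_ord_inj _ _ le_mn.
apply/bigmax_leqP => E unifE.
apply: leq_trans (leq_card_maximal_Atransversals_extend widen_inj closedA E) _.
exact/leq_card_maximal_Atransversals_h/uniform_extend_widen.
Qed.

End ExtremalNumbers.

Theorem theorem4 (a k r : nat) (hak : a < k) (hkr : k < r) :
  (forall n : nat, r <= n ->
     g k (upto a) n >= g r (upto a) n /\
     g r (upto a) n >= g k (upto a) (n - (r - k))) /\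
  (forall n : nat, r - k <= n ->
     h k (upto a) n >= h r (upto a) n /\
     h r (upto a) n >= h k (upto a) (n - (r - k))).
Proof.
have akr : a < k <= r by rewrite hak ltnW.
have def_r n : r - k <= n -> k + (n - (n - (r - k))) = r.
  by move=> le_rk_n; rewrite subKn // subnKC // ltnW.
split=> n le_n; split; [exact: leq_g_shadow| |exact: leq_h_shadow|].
- have le_rk_n : r - k <= n := leq_trans (leq_subr k r) le_n.
  rewrite -[in g r _ _](def_r n) //; apply: leq_g_extend.
  rewrite leq_subr subn_gt0 andbT; apply: leq_trans le_n.
  have k_gt0 : 0 < k := leq_ltn_trans (leq0n a) hak.
  by rewrite ltn_subrL k_gt0 (ltn_trans k_gt0).
- rewrite -[in h r _ _](def_r n) //.
  exact: leq_h_extend (@downward_closed_upto a) (leq_subr _ _).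
Qed.
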